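(* Let $\alpha\in(0,1]$, let $E\colon\mathbb{R}^n\to\mathbb{R}^n$ be a map, let $B\subseteq\mathbb{R}^n$ be an $E$-convex set and let $g_1\colon B\to\mathbb{R}$ be an $E$-convex function on $B$. If $g_2\colon U\to\mathbb{R}^\alpha$ is a non-decreasing generalized convex function, where $U\subseteq\mathbb{R}$ is an interval such that the range of $g_1$ is contained in $U$, then $g_2\circ g_1$ is a generalized $E$-convex function on $B$.
   Context: $\mathbb{R}^\alpha=\{a^\alpha : a\in\mathbb{R}\}$ is the real linear fractal set (Yang's fractal real line), with $a^\alpha+b^\alpha=(a+b)^\alpha$, $a^\alpha b^\alpha=(ab)^\alpha$, and $a^\alpha\le b^\alpha$ iff $a\le b$; for $\eta\in[0,1]$, $\eta^\alpha$ denotes the corresponding element of $\mathbb{R}^\alpha$, so that $\eta^\alpha+(1-\eta)^\alpha=1^\alpha$. All notions below refer to one and the same map $E$. A set $B\subseteq\mathbb{R}^n$ is $E$-convex if $\eta E(r_1)+(1-\eta)E(r_2)\in B$ for all $r_1,r_2\in B$, $\eta\in[0,1]$. A function $g\colon B\to\mathbb{R}$ is $E$-convex on $B$ if $g(\eta E(r_1)+(1-\eta)E(r_2))\le \eta g(E(r_1))+(1-\eta)g(E(r_2))$ for all $r_1,r_2\in B$, $\eta\in[0,1]$. A function $g\colon B\to\mathbb{R}^\alpha$ is generalized $E$-convex on $B$ if $B$ is $E$-convex and $g(\eta E(r_1)+(1-\eta)E(r_2))\le \eta^\alpha g(E(r_1))+(1-\eta)^\alpha g(E(r_2))$ for all $r_1,r_2\in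 B$, $\eta\in(0,1)$. For an interval $U\subseteq\mathbb{R}$, $g\colon U\to\mathbb{R}^\alpha$ is generalized convex if $g(\eta y_1+(1-\eta)y_2)\le\eta^\alpha g(y_1)+(1-\eta)^\alpha g(y_2)$ for all $y_1,y_2\in U$, $\eta\in[0,1]$. *)

(* Defs.v *)
From HB Require Import structures.
From mathcomp Require Import all_boot all_order all_algebra.
From mathcomp Require Import all_classical all_reals all_analysis.

Set Implicit Arguments.
Unset Strict Implicit.
Unset Printing Implicit Defensive.

Import Order.TTheory GRing.Theory Num.Theory.
Import numFieldNormedType.Exports.

Local Open Scope classical_set_scope.
Local Open Scope ring_scope.

(* The elements a^alpha of R^alpha are formal symbols, one for each real a,
   and not values of the real power function (a may be negative, and
   a^alpha + b^alpha is (a + b)^alpha).  The type therefore has a single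
   constructor, and alpha occurs only as its index. *)
Record fractal (R : realType) (alpha : R) := Fractal { fbase : R }.

Definition fpow (R : realType) (alpha : R) (a : R) : fractal alpha :=
  Fractal alpha a.

Section FractalStructures.
Context {R : realType} {alpha : R}.
Notation F := (fractal alpha).
Implicit Types x y z : F.

Lemma fbaseK : cancel (@fbase R alpha) (fpow alpha).
Proof. by case. Qed.

HB.instance Definition _ := Choice.copy F (can_type fbaseK).

Definition fadd x y : F := fpow alpha (fbase x + fbase y).
Definition fopp x : F := fpow alpha (- fbase x).
Definition fmul x y : F := fpow alpha (fbase x * fbase y).
Definition fle x y : bool := fbase x <= fbase y.
Definition flt x y : bool := fbase x < fbase y.

Lemma faddA : associative fadd.
Proof. by move=> x y z; rewrite /fadd /= addrA. Qed.

Lemma faddC : commutative fadd.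
Proof. by move=> x y; rewrite /fadd addrC. Qed.

Lemma fadd0 : left_id (fpow alpha 0) fadd.
Proof. by case=> a; rewrite /fadd /= add0r. Qed.

Lemma faddN : left_inverse (fpow alpha 0) fopp fadd.
Proof. by case=> a; rewrite /fadd /= addNr. Qed.

HB.instance Definition _ := GRing.isZmodule.Build F faddA faddC fadd0 faddN.

Lemma fmulA : associative fmul.
Proof. by move=> x y z; rewrite /fmul /= mulrA. Qed.

Lemma fmulC : commutative fmul.
Proof. by move=> x y; rewrite /fmul mulrC. Qed.

Lemma fmul1 : left_id (fpow alpha 1) fmul.
Proof. by case=> a; rewrite /fmul /= mul1r. Qed.

Lemma fmulDl : left_distributive fmul +%R.
Proof. by move=> x y z; congr Fractal; rewrite /= mulrDl. Qed.

Lemma fone_neq0 : fpow alpha 1 != 0 :> F.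
Proof. by apply/eqP => /(congr1 (@fbase R alpha)) /eqP; rewrite /= oner_eq0. Qed.

HB.instance Definition _ :=
  GRing.Zmodule_isComNzRing.Build F fmulA fmulC fmul1 fmulDl fone_neq0.

Lemma flt_def x y : flt x y = (y != x) && fle x y.
Proof. by rewrite /flt lt_def (can_eq fbaseK). Qed.

Lemma fle_refl : reflexive fle.
Proof. by move=> x; exact: lexx. Qed.

Lemma fle_anti : antisymmetric fle.
Proof. by move=> x y /le_anti /(can_inj fbaseK). Qed.

Lemma fle_trans : transitive fle.
Proof. by move=> y x z; exact: le_trans. Qed.

Lemma fle_total : total fle.
Proof. by move=> x y; exact: le_total. Qed.

HB.instance Definition _ :=
  Order.isPOrder.Build ring_display F flt_def fle_refl fle_anti fle_trans.
HB.instance Definition _ := Order.POrder_isTotal.Build ring_display F fle_total.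

Lemma fpowD (a b : R) : fpow alpha a + fpow alpha b = fpow alpha (a + b).
Proof. by []. Qed.

Lemma fpowM (a b : R) : fpow alpha a * fpow alpha b = fpow alpha (a * b).
Proof. by []. Qed.

Lemma ler_fpow (a b : R) : (fpow alpha a <= fpow alpha b) = (a <= b).
Proof. by []. Qed.

End FractalStructures.

(* A function on a subset of R^n or of R is a total function of which only the
   values on that subset are constrained; for r in an E-convex set B, E r is
   in B (eta = 1), so the conditions below involve only values on B. *)

Definition E_convex_set (R : realType) (n : nat) (E : 'rV[R]_n -> 'rV[R]_n)
    (B : set 'rV[R]_n) : Prop :=
  forall (r1 r2 : 'rV[R]_n) (eta : R), B r1 -> B r2 -> 0 <= eta <= 1 ->
    B (eta *: E r1 + (1 - eta) *: E r2).

Definition E_convex_fun (R : realType) (n : nat) (E : 'rV[R]_n -> 'rV[R]_n)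
    (B : set 'rV[R]_n) (g : 'rV[R]_n -> R) : Prop :=
  forall (r1 r2 : 'rV[R]_n) (eta : R), B r1 -> B r2 -> 0 <= eta <= 1 ->
    g (eta *: E r1 + (1 - eta) *: E r2)
      <= eta * g (E r1) + (1 - eta) * g (E r2).

Definition gen_E_convex_fun (R : realType) (alpha : R) (n : nat)
    (E : 'rV[R]_n -> 'rV[R]_n) (B : set 'rV[R]_n)
    (g : 'rV[R]_n -> fractal alpha) : Prop :=
  E_convex_set E B /\
  forall (r1 r2 : 'rV[R]_n) (eta : R), B r1 -> B r2 -> 0 < eta < 1 ->
    g (eta *: E r1 + (1 - eta) *: E r2)
      <= fpow alpha eta * g (E r1) + fpow alpha (1 - eta) * g (E r2).

Definition gen_convex_fun (R : realType) (alpha : R) (U : set R)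
    (g : R -> fractal alpha) : Prop :=
  forall y1 y2 eta : R, U y1 -> U y2 -> 0 <= eta <= 1 ->
    g (eta * y1 + (1 - eta) * y2)
      <= fpow alpha eta * g y1 + fpow alpha (1 - eta) * g y2.

(* Main.v *)
Require Import Defs.
From mathcomp Require Import all_boot all_order all_algebra.
From mathcomp Require Import all_classical all_reals all_analysis.
From mathcomp Require Import lra.

Set Implicit Arguments.
Unset Strict Implicit.
Unset Printing Implicit Defensive.

Import Order.TTheory GRing.Theory Num.Theory.
Import numFieldNormedType.Exports.

Local Open Scope classical_set_scope.
Local Open Scope ring_scope.

(** Two inequalities are chained: [g2], being monotone, preserves the [E]-convexity bound on [g1],
    and generalized convexity of [g2] at [g1 (E r1)] and [g1 (E r2)] bounds the result. Since [g2]
    is controlled only on [U], every argument must be placed there; the two lemmas serve this. *)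

(** Take [eta = 1] and both points equal to [r]. *)
Lemma E_convex_set_image (R : realType) (n : nat) (E : 'rV[R]_n -> 'rV[R]_n)
    (B : set 'rV[R]_n) (r : 'rV[R]_n) : E_convex_set E B -> B r -> B (E r).
Proof.
move=> hB Br; have := hB r r 1 Br Br.
by rewrite ler01 lexx subrr scale1r scale0r addr0; apply.
Qed.

Lemma is_interval_convex (R : realType) (U : set R) (x y eta : R) :
  is_interval U -> U x -> U y -> 0 <= eta <= 1 ->
  U (eta * x + (1 - eta) * y).
Proof.
move=> hU Ux Uy /andP[eta0 eta1].
(* [is_interval] speaks of points between ordered endpoints, hence the case split; the distances to
   the endpoints are [eta] and [1 - eta] times [|x - y|]. *)
by have [xy|/ltW yx] := leP x y; [apply: (hU x y)|apply: (hU y x)] => //;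
  apply/andP; split; nra.
Qed.

Theorem theorem2p1 (R : realType) (alpha : R) (halpha : 0 < alpha <= 1)
    (n : nat) (E : 'rV[R]_n -> 'rV[R]_n)
    (B : set 'rV[R]_n) (hB : E_convex_set E B)
    (g1 : 'rV[R]_n -> R) (hg1 : E_convex_fun E B g1)
    (U : set R) (hU : is_interval U) (hg1U : g1 @` B `<=` U)
    (g2 : R -> fractal alpha)
    (hg2_mono : forall x y : R, U x -> U y -> x <= y -> g2 x <= g2 y)
    (hg2_conv : gen_convex_fun U g2) :
  gen_E_convex_fun E B (g2 \o g1).
Proof.
split=> // r1 r2 eta Br1 Br2 /andP[/ltW eta0 /ltW eta1] /=.
have eta01 : 0 <= eta <= 1 by rewrite eta0.
have g1U r : B r -> U (g1 r) by move=> Br; apply: hg1U; exists r.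
have UE r : B r -> U (g1 (E r)) by move=> /(E_convex_set_image hB)/g1U.
apply: le_trans (hg2_conv _ _ _ (UE _ Br1) (UE _ Br2) eta01).
(* Monotonicity leaves two memberships in [U]: the value of [g1] at the combination, which lies in
   [B], and the combination of values of [g1]. *)
apply: hg2_mono; last exact: hg1.
- exact/g1U/hB.
- by apply: is_interval_convex => //; exact: UE.
Qed.
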